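(* Let $G$ be a Lie group and let $\psi$ be the action of $\mathfrak g_1^*=\mathfrak g^*$ on $TT^*G\simeq(G\circledS\mathfrak g_1^* )\circledS(\mathfrak g_2\circledS\mathfrak g_3^* )$, with the Tulczyjew symplectic form, given by $\psi_\lambda(g,\mu,\xi,\nu)=(g,\mu+\lambda,\xi,\nu)$. Poisson reduction of $TT^*G$ under the action $\psi$ of $\mathfrak g_1^*$ results in $G\circledS(\mathfrak g_2\circledS\mathfrak g_3^* )$ endowed with the bracket $$\{E,F\}(g,\xi,\nu)=\Big\langle T_e^*R_g\frac{\delta F}{\delta g},\frac{\delta E}{\delta\nu}\Big\rangle-\Big\langle T_e^*R_g\frac{\delta E}{\delta g},\frac{\delta F}{\delta\nu}\Big\rangle+\Big\langle\nu,\Big[\frac{\delta E}{\delta\nu},\frac{\delta F}{\delta\nu}\Big]\Big\rangle .$$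
   Context: $G$ is a (finite-dimensional) Lie group with identity $e$, $\mathfrak g=T_eG$; $\mathfrak g_i,\mathfrak g_i^*$ are copies of $\mathfrak g,\mathfrak g^*$. $R_g$ is right multiplication, $T_e^*R_g:T_g^*G\to\mathfrak g^*$ the dual of $T_eR_g$. In this statement the bracket $[\xi,\eta]$ on $\mathfrak g$ is the one determined by right invariant vector fields: if $X_\xi(g)=T_eR_g\xi$, then $[X_\xi,X_\eta]_{JL}=X_{[\xi,\eta]}$ (Jacobi-Lie bracket of vector fields). $\mathrm{ad}^*_\xi$ is the linear dual: $\langle\mathrm{ad}^*_\xi\mu,\eta\rangle=\langle\mu,[\xi,\eta]\rangle$. $T^*G$ is identified with $G\times\mathfrak g^*$ by $\alpha_g\mapsto(g,T_e^*R_g\alpha_g)$. $TT^*G=T(G\times\mathfrak g^* )$ is identified with $G\times\mathfrak g_1^*\times\mathfrak g_2\times\mathfrak g_3^*$ by sending $(V_g,V_\mu)$ at $(g,\mu)$ to $(g,\mu,\xi,\nu)$, $\xi=T_gR_{g^{-1}}V_g$, $\nu=V_\mu-\mathrm{ad}^*_\xi\mu$. The Tulczyjew form $\Omega_{TT^*G}$ is the tangent (complete) lift of the canonical form $d\theta$ of $T^*G$ ($\theta$ the Liouville form), transported by this map: on vectors $(T_eR_ga,\delta\mu,\delta\xi,\delta\nu)$, $(T_eR_g\bar a,\delta\bar\mu,\delta\bar\xi,\delta\bar\nu)$ at $(g,\mu,\xi,\nu)$ it equals $\langle\delta\nu,\bar a\rangle-\langle\delta\bar\nu,a\rangle-\langle\nu,[a,\bar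 a]\rangle+\langle\delta\mu,\delta\bar\xi\rangle-\langle\delta\bar\mu,\delta\xi\rangle$. Hamiltonian vector fields satisfy $i_{X_E}\Omega=-dE$; the Poisson bracket is $\{E,F\}=dF(X_E)$; the reduced bracket is its restriction to invariant functions, i.e. $E=E(g,\xi,\nu)$, $F=F(g,\xi,\nu)$. $\frac{\delta E}{\delta g}\in T_g^*G$, $\frac{\delta E}{\delta\nu}\in\mathfrak g$ are partial derivatives. *)

(* Defs.v *)
From HB Require Import structures.
From mathcomp Require Import all_boot all_order all_algebra.
From mathcomp Require Import all_classical all_reals all_analysis.
Import Order.TTheory GRing.Theory Num.Theory.
Import numFieldNormedType.Exports.

Set Implicit Arguments.
Unset Strict Implicit.
Unset Printing Implicit Defensive.

Local Open Scope classical_set_scope.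
Local Open Scope ring_scope.

Section SmoothFunctions.
Context {R : realType} {V W : normedModType R}.

(* C^k and C^oo on an open set, for finite-dimensional [V]. *)
Fixpoint Ck (k : nat) (O : set V) (f : V -> W) : Prop :=
  if k is k'.+1 then
    (forall x, O x -> differentiable f x) /\
    (forall v, Ck k' O (fun x => 'D_v f x))
  else {in O, continuous f}.

Definition smooth_on (O : set V) (f : V -> W) : Prop := forall k, Ck k O f.

End SmoothFunctions.

(* Charts are indexed by points, [chart p] being a chart around [p]. The
   tangent space at [p] is the model space [E], a tangent vector being given by
   its components in [chart p]. *)
Record atlas (R : realType) (E : normedModType R) (M : topologicalType) :=
  Atlas {
    dom : M -> set M;
    chart : M -> M -> E;
    unchart : M -> E -> M }.

Record smooth_manifold (R : realType) (E : normedModType R)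
    (M : topologicalType) (A : atlas E M) : Prop := SmoothManifold {
  smfd_hausdorff : hausdorff_space M;
  smfd_second_countable : @second_countable M;
  smfd_dom_open : forall p, open (dom A p);
  smfd_dom_self : forall p, dom A p p;
  smfd_chart_open : forall p, open (chart A p @` dom A p);
  smfd_chartK : forall p, {in dom A p, cancel (chart A p) (unchart A p)};
  smfd_chart_continuous : forall p, {in dom A p, continuous (chart A p)};
  smfd_unchart_continuous :
    forall p, {in chart A p @` dom A p, continuous (unchart A p)};
  smfd_transition : forall p q,
    smooth_on (chart A p @` (dom A p `&` dom A q)) (chart A q \o unchart A p) }.

Definition vec_atlas (R : realType) (E : normedModType R) : atlas E E :=
  Atlas (fun=> setT) (fun=> id) (fun=> id).

Definition prod_atlas (R : realType) (E F : normedModType R)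
    (M N : topologicalType) (A : atlas E M) (B : atlas F N) :
    atlas (E * F)%type (M * N)%type :=
  Atlas (fun p => dom A p.1 `*` dom B p.2)
        (fun p q => (chart A p.1 q.1, chart B p.2 q.2))
        (fun p x => (unchart A p.1 x.1, unchart B p.2 x.2)).

Section SmoothMaps.
Context {R : realType} {E F : normedModType R} {M N : topologicalType}.
Variables (A : atlas E M) (B : atlas F N).

Definition smooth_map (f : M -> N) : Prop :=
  continuous f /\
  forall p q, smooth_on (chart A p @` (dom A p `&` f @^-1` dom B q))
                        (chart B q \o f \o unchart A p).

(* T_p f : T_p M -> T_(f p) N *)
Definition tmap (f : M -> N) (p : M) : E -> F :=
  'd (chart B (f p) \o f \o unchart A p) (chart A p p).

End SmoothMaps.

Section ScalarsAndFields.
Context {R : realType} {E : normedModType R} {M : topologicalType}.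
Variable A : atlas E M.

Definition smooth_fun (f : M -> R) : Prop := smooth_map A (vec_atlas R) f.

Definition dfun (f : M -> R) (p : M) : E -> R := tmap A (vec_atlas R) f p.

(* A vector field [X] read in the chart [chart A p]. *)
Definition vf_in_chart (p : M) (X : M -> E) (x : E) : E :=
  let q := unchart A p x in tmap A (vec_atlas E) (chart A p) q (X q).

(* Jacobi-Lie bracket: [X, Y] f = X (Y f) - Y (X f). *)
Definition jacobi_lie (X Y : M -> E) (p : M) : E :=
  'd (vf_in_chart p Y) (chart A p p) (X p)
  - 'd (vf_in_chart p X) (chart A p p) (Y p).

(* [Om p u v] is the value of a two-form at [p]. *)
Definition hamiltonian (Om : M -> E -> E -> R) (f : M -> R) (X : M -> E) :
    Prop :=
  forall p v, Om p (X p) v = - dfun f p v.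

Definition ham_vf (Om : M -> E -> E -> R) (f : M -> R) (p : M) : E :=
  get [set u | forall v, Om p u v = - dfun f p v].

Definition poisson (Om : M -> E -> E -> R) (f h : M -> R) (p : M) : R :=
  dfun h p (ham_vf Om f p).

End ScalarsAndFields.

(* [pi : M -> Q] exhibits [Q] as the orbit manifold of a smooth action of the
   additive group [L] by Poisson maps of ([M], [br]), and [brQ] is the bracket
   induced on [Q] by the restriction of [br] to the invariant functions. *)
Record poisson_reduction (R : realType) (E F L : normedModType R)
    (M Q : topologicalType) (A : atlas E M) (B : atlas F Q)
    (br : (M -> R) -> (M -> R) -> M -> R) (act : L -> M -> M) (pi : M -> Q)
    (brQ : (Q -> R) -> (Q -> R) -> Q -> R) : Prop := PoissonReduction {
  pr_act0 : forall p, act 0 p = p;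
  pr_actD : forall l l' p, act (l + l') p = act l (act l' p);
  pr_act_smooth :
    smooth_map (prod_atlas (vec_atlas L) A) A (fun lp => act lp.1 lp.2);
  pr_act_poisson : forall l f h, smooth_fun A f -> smooth_fun A h ->
    br (f \o act l) (h \o act l) = br f h \o act l;
  pr_pi_smooth : smooth_map A B pi;
  pr_pi_surj : forall q, exists p, pi p = q;
  pr_pi_submersion : forall p w, exists v, tmap A B pi p v = w;
  pr_pi_orbits : forall p p', pi p = pi p' <-> exists l, p' = act l p;
  pr_invariant : forall f, smooth_fun A f ->
    (forall l, f \o act l = f) -> exists2 e, smooth_fun B e & f = e \o pi;
  pr_bracket : forall e f, smooth_fun B e -> smooth_fun B f ->
    br (e \o pi) (f \o pi) = brQ e f \o pi }.

HB.structure Definition TopologicalWithGroup :=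
  {G of Group G & Topological G}.

Record lieGroup (R : realType) (n : nat) := LieGroup {
  lie_sort :> TopologicalWithGroup.type;
  lie_atlas : atlas 'rV[R]_n lie_sort;
  lie_manifold : smooth_manifold lie_atlas;
  lie_mul_smooth : smooth_map (prod_atlas lie_atlas lie_atlas) lie_atlas
    (fun p => (p.1 * p.2)%g);
  lie_inv_smooth : smooth_map lie_atlas lie_atlas (fun g => (g^-1)%g) }.

Section LieGroup.
Context {R : realType} {n : nat}.
Variable G : lieGroup R n.

(* [g] is 'rV_n (the tangent space at the identity) and its dual is 'cV_n; the
   same types serve for the tangent and cotangent spaces at other points. *)
Local Notation g_ := 'rV[R]_n.
Local Notation gd_ := 'cV[R]_n.
Local Notation A := (lie_atlas G).

Definition pairing (mu : gd_) (a : g_) : R := (a *m mu) 0 0.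

(* The covector, resp. vector, representing a linear form on [g], resp. on
   its dual. *)
Definition to_covec (phi : g_ -> R) : gd_ := \col_i phi (delta_mx 0 i).
Definition to_vec (phi : gd_ -> R) : g_ := \row_i phi (delta_mx i 0).

(* T_h R_g : T_h G -> T_(h g) G *)
Definition TR (g h : G) : g_ -> g_ := tmap A A (fun x : G => (x * g)%g) h.

(* T_e^* R_g : T_g^* G -> g^* *)
Definition TstarR (g : G) (alpha : gd_) : gd_ :=
  to_covec (fun a => pairing alpha (TR g 1%g a)).

Definition right_inv_vf (xi : g_) (g : G) : g_ := TR g 1%g xi.

(* The bracket characterized by X_[xi, eta] = [X_xi, X_eta], read at the
   identity. *)
Definition lieb (xi eta : g_) : g_ :=
  jacobi_lie A (right_inv_vf xi) (right_inv_vf eta) 1%g.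

(* TT^*G in the right trivialization, with points ((g, mu), (xi, nu)): a
   covector alpha at g is (g, mu) with mu = T_e^* R_g alpha, and a vector
   (V_g, V_mu) tangent to G x g^* at (g, mu) is (g, mu, xi, nu) with
   xi = T_g R_(g^-1) V_g and nu = V_mu - ad^*_xi mu. *)
Definition TTstar : topologicalType := ((G * gd_) * (g_ * gd_))%type.
Definition TTstar_model : normedModType R := ((g_ * gd_) * (g_ * gd_))%type.
Definition TTstar_atlas : atlas TTstar_model TTstar :=
  prod_atlas (prod_atlas A (vec_atlas gd_))
             (prod_atlas (vec_atlas g_) (vec_atlas gd_)).

(* The complete lift of d theta, theta being the Liouville form of T^*G, carried
   to TTstar: the G-component of a tangent vector at (g, mu, xi, nu) is
   V = T_e R_g a, with a = T_g R_(g^-1) V. *)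
Definition tulczyjew (p : TTstar) (u v : TTstar_model) : R :=
  let: ((g, _), (_, nu)) := p in
  let: ((V, dmu), (dxi, dnu)) := u in
  let: ((V', dmu'), (dxi', dnu')) := v in
  let a := TR (g^-1)%g g V in
  let a' := TR (g^-1)%g g V' in
  pairing dnu a' - pairing dnu' a - pairing nu (lieb a a')
  + pairing dmu dxi' - pairing dmu' dxi.

Definition psi (lambda : gd_) (p : TTstar) : TTstar :=
  let: ((g, mu), (xi, nu)) := p in ((g, mu + lambda), (xi, nu)).

Definition reduced : topologicalType := (G * (g_ * gd_))%type.
Definition reduced_model : normedModType R := (g_ * (g_ * gd_))%type.
Definition reduced_atlas : atlas reduced_model reduced :=
  prod_atlas A (prod_atlas (vec_atlas g_) (vec_atlas gd_)).

Definition reduced_proj (p : TTstar) : reduced :=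
  let: ((g, _), (xi, nu)) := p in (g, (xi, nu)).

(* delta E / delta g, in T_g^* G *)
Definition partial_g (E : reduced -> R) (p : reduced) : gd_ :=
  let: (g, (xi, nu)) := p in
  to_covec (dfun A (fun h => E (h, (xi, nu))) g).

(* delta E / delta nu, in g^** = g *)
Definition partial_nu (E : reduced -> R) (p : reduced) : g_ :=
  let: (g, (xi, nu)) := p in
  to_vec (dfun (vec_atlas gd_) (fun m => E (g, (xi, m))) nu).

Definition reduced_bracket (E F : reduced -> R) (p : reduced) : R :=
  let: (g, (xi, nu)) := p in
  pairing (TstarR g (partial_g F p)) (partial_nu E p)
  - pairing (TstarR g (partial_g E p)) (partial_nu F p)
  + pairing nu (lieb (partial_nu E p) (partial_nu F p)).

End LieGroup.

(* Main.v *)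
Require Import Defs.
From HB Require Import structures.
From mathcomp Require Import all_boot all_order all_algebra.
From mathcomp Require Import all_classical all_reals all_analysis.
From mathcomp Require Import ring.

(* The Tulczyjew form is nondegenerate: [i_u Omega = - phi] can be solved
   explicitly for [u], testing against vectors in one slot at a time. The
   delta-nu slot gives a = d phi / d nu, the delta-mu slot gives delta-xi, the
   delta-xi slot gives delta-mu, and the a slot then gives delta-nu as
   ad^*_a nu minus the right-trivialized d phi / d g. For an invariant E the
   delta-xi component vanishes, and applying dF to this vector yields the
   reduced bracket. The one analytic point is that the bracket of g is linear
   in its second argument, which requires right invariant vector fields to be
   differentiable: in the chart at the identity X_xi is a first partial
   derivative of the smooth group multiplication. *)

Import Order.TTheory GRing.Theory Num.Theory.
Import numFieldNormedType.Exports.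

Set Implicit Arguments.
Unset Strict Implicit.
Unset Printing Implicit Defensive.

Local Open Scope classical_set_scope.
Local Open Scope ring_scope.

(** * Continuity and differential calculus *)

Lemma open_setX (S T : topologicalType) (U : set S) (V : set T) :
  open U -> open V -> open (U `*` V).
Proof.
move=> Uo Vo; rewrite openE => -[x y] [/= Ux Vy].
by exists (U, V) => //; split; exact: open_nbhs_nbhs.
Qed.

Lemma continuous_at_pair (S T U : topologicalType) (f : S -> T) (g : S -> U) x :
  {for x, continuous f} -> {for x, continuous g} ->
  {for x, continuous (fun y => (f y, g y))}.
Proof. by move=> fc gc; exact: cvg_pair. Qed.

Lemma continuous_fst (S T : topologicalType) : continuous (@fst S T).
Proof. by move=> x; exact: cvg_fst. Qed.

Lemma continuous_snd (S T : topologicalType) : continuous (@snd S T).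
Proof. by move=> x; exact: cvg_snd. Qed.

Lemma continuous_pair (S T U : topologicalType) (f : S -> T) (g : S -> U) :
  continuous f -> continuous g -> continuous (fun y => (f y, g y)).
Proof. by move=> fc gc x; apply: continuous_at_pair; [exact: fc|exact: gc]. Qed.

Lemma continuousT_comp (S T U : topologicalType) (f : S -> T) (g : T -> U) :
  continuous f -> continuous g -> continuous (g \o f).
Proof. by move=> fc gc x; apply: continuous_comp; [exact: fc|exact: gc]. Qed.

Lemma zero_section_continuous (S T U : topologicalType) (c : U) :
  continuous (fun x : S * T => ((x.1, c), x.2)).
Proof.
apply: continuous_pair; last exact: continuous_snd.
by apply: continuous_pair; [exact: continuous_fst|exact: cst_continuous].
Qed.

(** [diff] is a [get] over the linear maps satisfying the first-order expansion. Two functions with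
    the same germ satisfy the same expansions, so the choices coincide, also at points of
    non-differentiability. *)
Lemma near_eq_diff {R : realType} {V W : normedModType R} (f g : V -> W) x :
  {near x, f =1 g} -> 'd f x = 'd g x.
Proof.
move=> fg; rewrite /diff; congr (get _); apply/funext => df /=.
have fgx : f x = g x by exact: (nbhs_singleton fg).
have aux (h k : V -> W) : {near x, h =1 k} -> h x = k x ->
    (forall y, h y = h (lim (nbhs x)) + df (y - lim (nbhs x))
       +o_(y \near x) (y - lim (nbhs x))) ->
    (forall y, k y = k (lim (nbhs x)) + df (y - lim (nbhs x))
       +o_(y \near x) (y - lim (nbhs x))).
  move=> hk hkx; rewrite lim_id // => /funext /eqaddoP H.
  suff kE : k = (fun y => k x + df (y - x)) +o_ (nbhs x) (fun y => y - x).
    by apply: eqaddoEx => y; rewrite {1}kE.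
  apply/eqaddoP => e e0; near=> y.
  have -> : (k - (fun y => k x + df (y - x))) y
      = (h - (fun y => h x + df (y - x))) y.
    rewrite /GRing.opp /GRing.add /= hkx; congr (_ - _); apply/esym.
    by near: y; exact: hk.
  by near: y; exact: H.
apply/propext; split => -[dfc H]; split => //.
  exact: aux H.
by apply: aux H => //; near do apply/esym.
Unshelve. all: by end_near. Qed.

Lemma near_eq_differentiable {R : realType} {V W : normedModType R}
    (f g : V -> W) x :
  {near x, f =1 g} -> differentiable f x -> differentiable g x.
Proof.
move=> fg /diff_locallyP[dfc df]; apply/diff_locallyP.
rewrite -(near_eq_diff fg); split => //.
have fgx : f x = g x by exact: (nbhs_singleton fg).
move/eqaddoP : df => df; apply/eqaddoP => e e0; near=> h.
have -> : (g \o shift x - (cst (g x) + 'd f x)) h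
    = (f \o shift x - (cst (f x) + 'd f x)) h.
  rewrite /GRing.opp /GRing.add /= fgx; congr (_ - _); apply/esym.
  near: h.
  by move: fg; rewrite (near_shift 0 x) subr0.
by near: h; exact: df.
Unshelve. all: by end_near. Qed.

Lemma near_eq_is_diff {R : realType} {V W : normedModType R}
    (f g df : V -> W) x :
  {near x, f =1 g} -> is_diff x f df -> is_diff x g df.
Proof.
move=> fg [fx fE]; apply: DiffDef; first exact: near_eq_differentiable fx.
by rewrite -(near_eq_diff fg).
Qed.

Lemma linear_is_diff {R : realType} {V W : normedModType R}
    (f : {linear V -> W}) (x : V) : continuous f -> is_diff x f f.
Proof.
by move=> fc; apply: DiffDef; [exact: linear_differentiable | rewrite diff_lin].
Qed.

Lemma fst_is_diff {R : realType} {V W : normedModType R} (x : V * W) :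
  is_diff x fst fst.
Proof. by apply: linear_is_diff => y; exact: cvg_fst. Qed.

Lemma snd_is_diff {R : realType} {V W : normedModType R} (x : V * W) :
  is_diff x snd snd.
Proof. by apply: linear_is_diff => y; exact: cvg_snd. Qed.

Lemma diff_linear_combination (R : realType) (V W : normedModType R)
    (f g : V -> W) x c v : differentiable f x -> differentiable g x ->
  'd (c *: f + g) x v = c *: 'd f x v + 'd g x v.
Proof.
move=> df dg; have dcf : differentiable (c *: f) x by exact: differentiableZ.
transitivity ('d (c *: f) x v + 'd g x v).
  exact: (congr1 (@^~ v) (diffD dcf dg)).
by congr (_ + _); exact: (congr1 (@^~ v) (diffZ c df)).
Qed.

Lemma pair_cst_is_diff (R : realType) (E F : normedModType R) (x : E) (c : F) :
  is_diff x (fun y => (y, c)) (fun v => (v, 0)).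
Proof. exact: is_diff_pair. Qed.

Lemma cst_pair_is_diff (R : realType) (E F : normedModType R) (x : E) (c : F) :
  is_diff x (fun y => (c, y)) (fun v => (0, v)).
Proof. exact: is_diff_pair. Qed.

Lemma add_cst_is_diff (R : realType) (E : normedModType R) (x c : E) :
  is_diff x (fun y => y + c) id.
Proof.
have did : differentiable id x by [].
have dc : differentiable (cst c) x by exact: differentiable_cst.
apply: DiffDef; first exact: (differentiableD did dc).
apply: etrans (diffD did dc) _; apply/funext => v.
have idE : 'd id x v = v by rewrite diff_val.
have cE : 'd (cst c) x v = 0 by rewrite diff_cst.
exact: etrans (f_equal2 +%R idE cE) (addr0 v).
Qed.

(** This map, which forgets the mu slot, is the expression of [reduced_proj] in charts. *)
Lemma reduced_is_diff (R : realType) (E F H : normedModType R)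
    (x : (E * F) * H) :
  is_diff x (fun y => (y.1.1, y.2)) (fun y => (y.1.1, y.2)).
Proof.
have H1 := fst_is_diff x; have H2 := fst_is_diff x.1.
have H3 := snd_is_diff x.
have H4 : is_diff x (fst \o fst) (fst \o fst) := is_diff_comp H1 H2.
exact: (is_diff_pair H4 H3).
Qed.

(** * Stability of C^k maps on open sets *)

Section CkTheory.
Context {R : realType}.
Implicit Types U V W : normedModType R.

(** Since [O] is open, equality on [O] is equality near each of its points; it therefore passes to
    directional derivatives, and induction applies. *)
Lemma eq_Ck V W k (O : set V) (f g : V -> W) :
  open O -> (forall x, O x -> f x = g x) -> Ck k O f -> Ck k O g.
Proof.
move=> Oo; elim: k f g => [|k IH] f g fg /=.
  move=> fc x xO; move: (xO); rewrite inE => Ox.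
  have nfg : {near x, f =1 g}.
    by near=> y; apply: fg; near: y; exact: open_nbhs_nbhs.
  rewrite /continuous_at -(fg _ Ox); apply: cvg_trans (fc _ xO).
  by apply: near_eq_cvg; exact: nfg.
move=> [df Df].
have nfg x : O x -> {near x, f =1 g}.
  by move=> Ox; near=> y; apply: fg; near: y; exact: open_nbhs_nbhs.
split => [x Ox|v].
  by apply: near_eq_differentiable (nfg _ Ox) _; exact: df.
by apply: IH (Df v) => x Ox; apply: near_eq_derive; exact: nfg.
Unshelve. all: by end_near. Qed.

(** The derivative of [f \o L] along [v] is that of [f] along [L v], again composed with [L], so the
    induction closes without a higher-order chain rule. Linear inner maps are enough: the nonlinear
    factors below are chart transitions and local expressions of given smooth functions, precomposed
    with projections or inclusions. *)
Lemma Ck_comp_linear U V W k (O : set V) (O' : set U) (L : U -> V)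
    (f : V -> W) :
  linear L -> continuous L -> (forall x, O' x -> O (L x)) -> Ck k O f ->
  Ck k O' (f \o L).
Proof.
move=> Llin Lc LO.
pose L' : {linear U -> V} := HB.pack L (GRing.isLinear.Build _ _ _ _ L Llin).
elim: k f => [|k IH] f /=.
  move=> fc x; rewrite inE => /LO OLx.
  by apply: continuous_comp; [exact: Lc|apply: fc; rewrite inE].
move=> [df Df]; split => [x /LO OLx|v].
  apply: differentiable_comp; last exact: df.
  exact: (@linear_differentiable _ _ _ L').
(* The difference quotients already agree, by linearity of [L], so this is an equality of functions
   on the whole space. *)
have -> : (fun x => 'D_v (f \o L) x) = (fun x => 'D_(L v) f (L x)).
  apply/funext => x; rewrite /derive.
  set F := fun h : R => _; set F' := fun h : R => _.
  suff -> : F = F' by [].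
  by apply/funext => h; rewrite /F /F' /= Llin.
exact: IH (Df _).
Qed.

Lemma Ck_pair U V W k (O : set U) (f : U -> V) (g : U -> W) :
  open O -> Ck k O f -> Ck k O g -> Ck k O (fun x => (f x, g x)).
Proof.
move=> Oo; elim: k f g => [|k IH] f g /=.
  by move=> fc gc x xO; apply: cvg_pair; [exact: fc|exact: gc].
move=> [df Df] [dg Dg]; split => [x Ox|v].
  by apply: differentiable_pair; [exact: df|exact: dg].
apply: eq_Ck Oo _ (IH _ _ (Df v) (Dg v)) => x Ox.
have dfg : differentiable (fun x => (f x, g x)) x.
  by apply: differentiable_pair; [exact: df|exact: dg].
rewrite !deriveE //; [|exact: dg|exact: df].
by rewrite diff_pair //; [exact: df|exact: dg].
Qed.

Lemma Ck_cst V W k (O : set V) (c : W) : Ck k O (cst c).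
Proof.
elim: k c => [|k IH] c /=; first by move=> x _; exact: cvg_cst.
split=> [x _|v]; first exact: differentiable_cst.
have -> : (fun x => 'D_v (cst c) x) = cst (0 : W).
  by apply/funext => x; rewrite derive_cst.
exact: IH.
Qed.

Lemma Ck_linear V W k (O : set V) (L : V -> W) :
  linear L -> continuous L -> Ck k O L.
Proof.
move=> Llin Lc.
pose L' : {linear V -> W} := HB.pack L (GRing.isLinear.Build _ _ _ _ L Llin).
case: k => [|k] /=; first by move=> x _; exact: Lc.
split=> [x _|v]; first exact: (@linear_differentiable _ _ _ L').
have -> : (fun x => 'D_v L x) = cst (L v).
  apply/funext => x; rewrite deriveE; last exact: (@linear_differentiable _ _ _ L').
  by rewrite -[L]/(L' : _ -> _) diff_lin.
exact: Ck_cst.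
Qed.

End CkTheory.

(** * Manifolds *)

(* The part of [smooth_manifold] used below; unlike the latter it passes to
   products without any second countability argument. *)
Record local_charts (R : realType) (E : normedModType R) (M : topologicalType)
    (A : atlas E M) : Prop := LocalCharts {
  lc_dom_open : forall p, open (dom A p);
  lc_dom_self : forall p, dom A p p;
  lc_chart_open : forall p, open (chart A p @` dom A p);
  lc_chartK : forall p q, dom A p q -> unchart A p (chart A p q) = q;
  lc_unchart_continuous :
    forall p x, (chart A p @` dom A p) x -> {for x, continuous (unchart A p)} }.

Lemma manifold_local_charts (R : realType) (E : normedModType R)
    (M : topologicalType) (A : atlas E M) :
  smooth_manifold A -> local_charts A.
Proof.
case=> _ _ dO ds cO cK _ uc _; split => //.
  by move=> p q pq; apply: cK; rewrite inE.
by move=> p x px; apply: uc; rewrite inE.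
Qed.

Lemma vec_local_charts (R : realType) (E : normedModType R) :
  local_charts (vec_atlas E).
Proof.
split => //.
- by move=> p; exact: openT.
- by move=> p /=; rewrite image_id; exact: openT.
- by move=> p x _; exact: cvg_id.
Qed.

Lemma prod_local_charts (R : realType) (E F : normedModType R)
    (M N : topologicalType) (A : atlas E M) (B : atlas F N) :
  local_charts A -> local_charts B -> local_charts (prod_atlas A B).
Proof.
move=> hA hB.
have imE p : chart (prod_atlas A B) p @` dom (prod_atlas A B) p
    = (chart A p.1 @` dom A p.1) `*` (chart B p.2 @` dom B p.2).
  apply/seteqP; split=> [_ [[a b]] [/= da db] <-|[x y] /= [[a da <-] [b db <-]]].
    by split; [exists a|exists b].
  by exists (a, b).
split.
- by move=> p; apply: open_setX; exact: lc_dom_open.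
- by move=> p; split; exact: lc_dom_self.
- by move=> p; rewrite imE; apply: open_setX; exact: lc_chart_open.
- by move=> p [q r] [/= dq dr]; rewrite !lc_chartK.
- move=> p z; rewrite imE => -[px py].
  apply: (@continuous_at_pair _ _ _ (unchart A p.1 \o fst)
                                    (unchart B p.2 \o snd)).
    apply: continuous_comp; first exact: continuous_fst.
    exact: lc_unchart_continuous.
  apply: continuous_comp; first exact: continuous_snd.
  exact: lc_unchart_continuous.
Qed.

(** Inside the open chart image, the set is the preimage of [U] under the continuous inverse
    chart. *)
Lemma open_chart_image (R : realType) (E : normedModType R)
    (M : topologicalType) (A : atlas E M) p (U : set M) :
  local_charts A -> open U -> open (chart A p @` (dom A p `&` U)).
Proof.
move=> hA Uo.
have -> : chart A p @` (dom A p `&` U)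
    = chart A p @` dom A p `&` (unchart A p @^-1` U).
  apply/seteqP; split => [_ [q [dq Uq] <-]|_ [[q dq <-]] /=].
    by split; [exists q|rewrite /= lc_chartK].
  by rewrite lc_chartK // => Uq; exists q.
rewrite openE => x [px Ux]; apply: filterI.
  by apply: open_nbhs_nbhs; split => //; exact: lc_chart_open.
by apply: (lc_unchart_continuous hA px); exact: open_nbhs_nbhs.
Qed.

(** The local expression is the one that [tmap] differentiates, so this is the condition under which
    the chain rule for [tmap] applies. *)
Definition mdifferentiable (R : realType) (E F : normedModType R)
    (M N : topologicalType) (A : atlas E M) (B : atlas F N) (f : M -> N) p :=
  differentiable (chart B (f p) \o f \o unchart A p) (chart A p p).

Lemma smooth_map_mdifferentiable (R : realType) (E F : normedModType R)
    (M N : topologicalType) (A : atlas E M) (B : atlas F N) (f : M -> N) p :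
  local_charts A -> local_charts B ->
  smooth_map A B f -> mdifferentiable A B f p.
Proof.
move=> hA hB [_ /(_ p (f p) 1%N)[df _]]; apply: df.
by exists p => //; split; exact: lc_dom_self.
Qed.

Lemma near_unchartK (R : realType) (E : normedModType R) (M : topologicalType)
    (A : atlas E M) p : local_charts A ->
  \forall x \near chart A p p, chart A p (unchart A p x) = x.
Proof.
move=> hA; have : nbhs (chart A p p) (chart A p @` dom A p).
  apply: open_nbhs_nbhs; split; first exact: lc_chart_open.
  by exists p => //; exact: lc_dom_self.
by apply: filterS => _ [q dq <-]; rewrite lc_chartK.
Qed.

(** The chart inserted at [f p] cancels only where [f] takes values in its domain. Continuity of [f]
    at [p] makes this a neighbourhood, and the differential depends only on the germ. *)
Lemma tmap_comp (R : realType) (E F H : normedModType R)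
    (M N P : topologicalType) (A : atlas E M) (B : atlas F N) (C : atlas H P)
    (f : M -> N) (g : N -> P) p v :
  local_charts A -> local_charts B -> {for p, continuous f} ->
  mdifferentiable A B f p -> mdifferentiable B C g (f p) ->
  tmap B C g (f p) (tmap A B f p v) = tmap A C (g \o f) p v.
Proof.
move=> hA hB fc df dg.
have pK : unchart A p (chart A p p) = p.
  by rewrite lc_chartK //; exact: lc_dom_self.
rewrite /tmap.
set f' := (X in 'd X (chart A p p) v).
set g' := (X in 'd X (chart B (f p) (f p)) _).
have f'p : f' (chart A p p) = chart B (f p) (f p) by rewrite /f' /= pK.
have dg' : differentiable g' (f' (chart A p p)) by rewrite f'p.
transitivity ('d (g' \o f') (chart A p p) v).
  by rewrite diff_comp // f'p.
rewrite (@near_eq_diff _ _ _ _ (chart C (g (f p)) \o (g \o f) \o unchart A p)) //.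
have fu : {for chart A p p, continuous (f \o unchart A p)}.
  apply: continuous_comp; [apply: lc_unchart_continuous => // | by rewrite pK].
  by exists p => //; exact: lc_dom_self.
have : \forall x \near chart A p p, dom B (f p) (f (unchart A p x)).
  apply: (fu (dom B (f p))); rewrite /= pK; apply: open_nbhs_nbhs.
  by split; [exact: lc_dom_open|exact: lc_dom_self].
by apply: filterS => x dx; rewrite /f' /g' /= lc_chartK.
Qed.

(** In one term of the bracket [Z] is differentiated, which uses the differentiability of [X] and
    [Y]; in the other it enters through its value at [p], as the argument of a linear map. *)
Lemma jacobi_lie_linear (R : realType) (E : normedModType R)
    (M : topologicalType) (A : atlas E M) (T X Y Z : M -> E) p c :
  (forall q, Z q = c *: X q + Y q) ->
  differentiable (vf_in_chart A p X) (chart A p p) ->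
  differentiable (vf_in_chart A p Y) (chart A p p) ->
  jacobi_lie A T Z p = c *: jacobi_lie A T X p + jacobi_lie A T Y p.
Proof.
move=> ZE dX dY; rewrite /jacobi_lie ZE.
have -> : vf_in_chart A p Z = c *: vf_in_chart A p X + vf_in_chart A p Y.
  by apply/funext => x; rewrite /vf_in_chart ZE; apply: etrans (linearP _ _ _ _) _.
have E1 := diff_linear_combination c (T p) dX dY.
have E2 : 'd (vf_in_chart A p T) (chart A p p) (c *: X p + Y p)
    = c *: 'd (vf_in_chart A p T) (chart A p p) (X p)
      + 'd (vf_in_chart A p T) (chart A p p) (Y p) by exact: linearP.
apply: etrans (f_equal2 (fun x y => x - y) E1 E2) _.
by rewrite scalerBr opprD addrACA.
Qed.

(** * Lie groups *)

Section RightTranslations.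
Context {R : realType} {n : nat}.
Variable G : lieGroup R n.
Local Notation A := (lie_atlas G).

Let hA : local_charts A.
Proof. exact: manifold_local_charts (lie_manifold G). Qed.

Let hAA : local_charts (prod_atlas A A).
Proof. exact: prod_local_charts. Qed.

Let chartK (g : G) : unchart A g (chart A g g) = g.
Proof. by rewrite lc_chartK //; exact: lc_dom_self. Qed.

Lemma rtrans_continuous (g : G) : continuous (fun h : G => (h * g)%g).
Proof.
move=> h; have [mc _] := lie_mul_smooth G.
apply: (@continuous_comp _ _ _ (fun h => (h, g)) (fun p => (p.1 * p.2)%g)).
  by apply: cvg_pair; [exact: cvg_id|exact: cvg_cst].
exact: mc.
Qed.

(** In charts, right translation is the multiplication restricted to a slice where the second factor
    is constant. *)
Lemma rtrans_mdifferentiable (g h : G) :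
  mdifferentiable A A (fun h : G => (h * g)%g) h.
Proof.
have dm : mdifferentiable (prod_atlas A A) A (fun p => (p.1 * p.2)%g) (h, g).
  exact: smooth_map_mdifferentiable hAA hA (lie_mul_smooth G).
rewrite /mdifferentiable.
have -> : chart A (h * g)%g \o (fun h : G => (h * g)%g) \o unchart A h
    = (chart A (h * g)%g \o (fun p => (p.1 * p.2)%g)
       \o unchart (prod_atlas A A) (h, g)) \o (fun y => (y, chart A g g)).
  by apply/funext => y /=; rewrite chartK.
exact: differentiable_comp.
Qed.

Lemma TR_linear (g h : G) c (v w : 'rV[R]_n) :
  TR g h (c *: v + w) = c *: TR g h v + TR g h w.
Proof. by rewrite /TR /tmap linearP. Qed.

Lemma TR0 (g h : G) : TR g h 0 = 0.
Proof. by rewrite /TR /tmap linear0. Qed.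

(** Chain rule for the composite of two right translations; associativity puts the factor applied
    first on the left. *)
Lemma TR_comp (g g' h : G) v : TR g' (h * g)%g (TR g h v) = TR (g * g')%g h v.
Proof.
have := @tmap_comp _ _ _ _ _ _ _ A A A (fun x : G => (x * g)%g)
  (fun x : G => (x * g')%g) h v hA hA.
rewrite /TR => ->; [| exact: rtrans_continuous
  | exact: rtrans_mdifferentiable | exact: rtrans_mdifferentiable].
by congr (tmap _ _ _ h v); apply/funext => x /=; rewrite mulgA.
Qed.

Lemma TR1 (h : G) v : TR 1%g h v = v.
Proof.
rewrite /TR /tmap mulg1.
have -> : chart A h \o (fun x : G => (x * 1)%g) \o unchart A h
    = chart A h \o unchart A h by apply/funext => x /=; rewrite mulg1.
(* The composite is the identity only on the chart image, hence the passage through germs. *)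
suff : is_diff (chart A h h) (chart A h \o unchart A h) idfun.
  by move=> H; rewrite diff_val.
apply: near_eq_is_diff (is_diff_id _).
by apply: filterS (near_unchartK h hA) => x.
Qed.

(** With [TRVK], this lets a tangent vector at [g] and its right trivialization be exchanged
    freely. *)
Lemma TRK (g : G) : cancel (TR g 1%g) (TR (g^-1)%g g).
Proof.
move=> v; have := TR_comp g (g^-1)%g 1%g v.
by rewrite mul1g mulgV TR1.
Qed.

Lemma TRVK (g : G) : cancel (TR (g^-1)%g g) (TR g 1%g).
Proof.
move=> v; have := TR_comp (g^-1)%g g g v.
by rewrite mulgV mulVg TR1.
Qed.

(** * Right invariant vector fields in the chart at the identity *)

Let mul_loc : 'rV[R]_n * 'rV[R]_n -> 'rV[R]_n :=
  chart A 1%g \o (fun p : G * G => (p.1 * p.2)%g)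
  \o unchart (prod_atlas A A) (1%g, 1%g).

Let mul_dom : set ('rV[R]_n * 'rV[R]_n) :=
  chart (prod_atlas A A) (1%g, 1%g) @` (dom (prod_atlas A A) (1%g, 1%g)
    `&` (fun p : G * G => (p.1 * p.2)%g) @^-1` dom A 1%g).

Let mul_loc_smooth : smooth_on mul_dom mul_loc.
Proof. by have [_] := lie_mul_smooth G; apply. Qed.

Let mul_domE x : (chart A 1%g @` dom A (1%g : G)) x ->
  mul_dom (chart A 1%g (1%g : G), x).
Proof.
move=> [q dq <-]; exists (1%g, q) => //; split; last by rewrite /= mul1g.
by split => //; exact: lc_dom_self.
Qed.

(** The value at q of the field is the derivative of h -> h q at the identity along [xi]. The chain
    rule merges this with the chart at the identity into a partial derivative in the first
    factor. *)
Let right_inv_vf_chart (xi x : 'rV[R]_n) : (chart A 1%g @` dom A (1%g : G)) x ->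
  vf_in_chart A 1%g (right_inv_vf xi) x
  = 'D_(xi, 0) mul_loc (chart A 1%g (1%g : G), x).
Proof.
move=> Dx; have [q dq qx] := Dx.
have ux : unchart A 1%g x = q by rewrite -qx lc_chartK.
have dm : differentiable mul_loc (chart A 1%g (1%g : G), x).
  by have [+ _] := mul_loc_smooth 1; apply; exact: mul_domE.
rewrite deriveE // /vf_in_chart ux /right_inv_vf.
have := @tmap_comp _ _ _ _ _ _ _ A A (vec_atlas _)
  (fun h : G => (h * q)%g) (chart A 1%g) 1%g xi hA hA.
rewrite /TR mul1g => ->.
- rewrite /tmap /=.
  have -> : id \o (chart A 1%g \o (fun h : G => (h * q)%g)) \o unchart A 1%g
      = mul_loc \o (fun y => (y, x)).
    by apply/funext => y /=; rewrite /mul_loc /= ux.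
  have := pair_cst_is_diff (chart A 1%g (1%g : G)) x => H.
  by rewrite diff_comp // diff_val.
- exact: rtrans_continuous.
- have := rtrans_mdifferentiable q 1%g; by [].
(* Read in the chart at [q], the chart at the identity is a transition map. *)
- have [+ _] := smfd_transition (lie_manifold G) q 1%g 1; apply.
  by exists q => //; split => //; exact: lc_dom_self.
Qed.

Lemma right_inv_vf_differentiable (xi : 'rV[R]_n) :
  differentiable (vf_in_chart A 1%g (right_inv_vf xi)) (chart A 1%g (1%g : G)).
Proof.
pose e0 := chart A 1%g (1%g : G).
apply: (@near_eq_differentiable _ _ _ (fun x => 'D_(xi, 0) mul_loc (e0, x))).
  have : nbhs e0 (chart A 1%g @` dom A (1%g : G)).
    apply: open_nbhs_nbhs; split; first exact: lc_chart_open.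
    by exists 1%g => //; exact: lc_dom_self.
  by apply: filterS => x Dx; rewrite right_inv_vf_chart.
apply: (@differentiable_comp _ _ _ _ (fun x => (e0, x)) ('D_(xi, 0) mul_loc)).
  by have [] := cst_pair_is_diff e0 e0.
(* Order 2: one derivative produces the field, the other differentiates it. *)
have [_ /(_ (xi, 0))[+ _]] := mul_loc_smooth 2; apply; apply: mul_domE.
by exists 1%g => //; exact: lc_dom_self.
Qed.

Lemma lieb_linear (a : 'rV[R]_n) : linear (lieb G a).
Proof.
move=> c b b'; apply: jacobi_lie_linear.
- by move=> g; exact: TR_linear.
- exact: right_inv_vf_differentiable.
- exact: right_inv_vf_differentiable.
Qed.

End RightTranslations.

(** * The Tulczyjew form *)

Section Pairing.
Context {R : realType} {n : nat}.
Implicit Types (a b : 'rV[R]_n) (mu nu : 'cV[R]_n).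

Lemma pairing0l a : pairing 0 a = 0.
Proof. by rewrite /pairing mulmx0 mxE. Qed.

Lemma pairing0r mu : pairing mu 0 = 0.
Proof. by rewrite /pairing mul0mx mxE. Qed.

Lemma pairing_linear mu c a b :
  pairing mu (c *: a + b) = c * pairing mu a + pairing mu b.
Proof. by rewrite /pairing mulmxDl -scalemxAl !mxE. Qed.

Lemma to_covecE (phi : 'rV[R]_n -> R) a :
  (forall c x y, phi (c *: x + y) = c * phi x + phi y) ->
  pairing (to_covec phi) a = phi a.
Proof.
move=> phi_lin.
pose phiL : {linear 'rV[R]_n -> R^o} :=
  HB.pack (phi : _ -> R^o) (GRing.isLinear.Build _ _ _ _ _ phi_lin).
rewrite [in RHS](row_sum_delta a) -[phi]/(phiL : _ -> _) linear_sum.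
rewrite /pairing mxE; apply: eq_bigr => i _.
by rewrite linearZ /= mxE.
Qed.

Lemma to_vecE (phi : 'cV[R]_n -> R) mu :
  (forall c x y, phi (c *: x + y) = c * phi x + phi y) ->
  pairing mu (to_vec phi) = phi mu.
Proof.
move=> phi_lin.
(* Transposition reduces the claim to [to_covecE]. *)
have -> : pairing mu (to_vec phi) = pairing (to_covec (phi \o trmx)) mu^T.
  rewrite /pairing !mxE; apply: eq_bigr => i _.
  by rewrite !mxE /= trmx_delta mulrC.
rewrite to_covecE /= ?trmxK // => c x y.
by rewrite linearP phi_lin.
Qed.

Lemma eq_pairing_l mu nu : (forall a, pairing mu a = pairing nu a) -> mu = nu.
Proof.
move=> H; apply/matrixP => i j; rewrite ord1.
have := H (delta_mx 0 i).
by rewrite /pairing -!rowE !mxE.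
Qed.

Lemma eq_pairing_r a b : (forall mu, pairing mu a = pairing mu b) -> a = b.
Proof.
move=> H; apply/matrixP => i j; rewrite ord1.
have := H (delta_mx j 0).
by rewrite /pairing -!colE !mxE.
Qed.

End Pairing.

(** * Nondegeneracy and the explicit Hamiltonian vector *)

Section Tulczyjew.
Context {R : realType} {n : nat}.
Variable G : lieGroup R n.
Local Notation A := (lie_atlas G).

Lemma lieb0 (a : 'rV[R]_n) : lieb G a 0 = 0.
Proof.
by have := lieb_linear G a (-1) 0 0; rewrite scaler0 addr0 scaleN1r addNr.
Qed.

Lemma pairing_TstarR (g : G) (alpha : 'cV[R]_n) a :
  pairing (TstarR g alpha) a = pairing alpha (TR g 1%g a).
Proof.
by rewrite to_covecE // => c x y; rewrite TR_linear pairing_linear.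
Qed.

(** For phi = df, these are the components of the Hamiltonian vector field of f: T_e R_g a with a =
    df/dnu, then -df/dxi, df/dmu and ad^*_a nu - T_e^* R_g (df/dg). The slots g and nu are
    conjugate, as are mu and xi. *)
Definition tulczyjew_sol (p : TTstar G) (phi : @TTstar_model R n -> R) :
    @TTstar_model R n :=
  let: ((g, _), (_, nu)) := p in
  let a := to_vec (fun m => phi ((0, 0), (0, m))) in
  ((TR g 1%g a, to_covec (fun x => - phi ((0, 0), (x, 0)))),
   (to_vec (fun m => phi ((0, m), (0, 0))),
    to_covec (fun b =>
      pairing nu (lieb G a b) - phi ((TR g 1%g b, 0), (0, 0))))).

(** The equivalence carries both uniqueness, by testing on single slots, and existence, by splitting
    [phi] over the four slots. *)
Lemma tulczyjew_solP (p : TTstar G) (phi : @TTstar_model R n -> R)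
    (u : @TTstar_model R n) :
  (forall c x y, phi (c *: x + y) = c * phi x + phi y) ->
  (forall v, tulczyjew p u v = - phi v) <-> u = tulczyjew_sol p phi.
Proof.
move=> phi_lin; case: p => [[g mu] [xi nu]].
have phiD x y : phi (x + y) = phi x + phi y.
  by have := phi_lin 1 x y; rewrite scale1r mul1r.
(* Linearity of [phi] slot by slot, in the form required by [to_vecE] and [to_covecE]. *)
have lin_dnu c (x y : 'cV[R]_n) : phi ((0, 0), (0, c *: x + y))
    = c * phi ((0, 0), (0, x)) + phi ((0, 0), (0, y)).
  by rewrite -phi_lin; congr phi; congr ((_, _), (_, _)) => /=;
    rewrite scaler0 addr0.
have lin_dmu c (x y : 'cV[R]_n) : phi ((0, c *: x + y), (0, 0))
    = c * phi ((0, x), (0, 0)) + phi ((0, y), (0, 0)).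
  by rewrite -phi_lin; congr phi; congr ((_, _), (_, _)) => /=;
    rewrite scaler0 addr0.
have lin_dxi c (x y : 'rV[R]_n) : phi ((0, 0), (c *: x + y, 0))
    = c * phi ((0, 0), (x, 0)) + phi ((0, 0), (y, 0)).
  by rewrite -phi_lin; congr phi; congr ((_, _), (_, _)) => /=;
    rewrite scaler0 addr0.
have lin_V c (x y : 'rV[R]_n) : phi ((c *: x + y, 0), (0, 0))
    = c * phi ((x, 0), (0, 0)) + phi ((y, 0), (0, 0)).
  by rewrite -phi_lin; congr phi; congr ((_, _), (_, _)) => /=;
    rewrite scaler0 addr0.
have lin_xi' c (x y : 'rV[R]_n) : - phi ((0, 0), (c *: x + y, 0))
    = c * - phi ((0, 0), (x, 0)) + - phi ((0, 0), (y, 0)).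
  by rewrite lin_dxi mulrN opprD.
have lin_a' a c (x y : 'rV[R]_n) :
    pairing nu (lieb G a (c *: x + y))
      - phi ((TR g 1%g (c *: x + y), 0), (0, 0))
    = c * (pairing nu (lieb G a x) - phi ((TR g 1%g x, 0), (0, 0)))
      + (pairing nu (lieb G a y) - phi ((TR g 1%g y, 0), (0, 0))).
  rewrite lieb_linear TR_linear pairing_linear lin_V mulrBr.
  by rewrite opprD addrACA.
split.
- case: u => [[V dmu] [dxi dnu]] H.
  (* The form sees [V] through its trivialization; [TRVK] then recovers [V] itself. *)
  have Va : TR (g^-1)%g g V = to_vec (fun m => phi ((0, 0), (0, m))).
    apply: eq_pairing_r => m; rewrite to_vecE //.
    have /= := H ((0, 0), (0, m)).
    rewrite TR0 lieb0 !pairing0r !pairing0l sub0r !subr0 addr0.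
    by move=> /oppr_inj.
  congr ((_, _), (_, _)).
  + by rewrite -Va TRVK.
  + apply: eq_pairing_l => x; rewrite to_covecE //.
    have /= := H ((0, 0), (x, 0)).
    by rewrite TR0 lieb0 !pairing0r !pairing0l !subr0 !add0r.
  + apply: eq_pairing_r => m; rewrite to_vecE //.
    have /= := H ((0, m), (0, 0)).
    rewrite TR0 lieb0 !pairing0r !pairing0l !subr0 !add0r.
    by move=> /oppr_inj.
  + apply: eq_pairing_l => b; rewrite to_covecE //.
    (* This test vector has trivialization [b], by [TRK]. *)
    have /= := H ((TR g 1%g b, 0), (0, 0)).
    rewrite TRK !pairing0r !pairing0l !subr0 addr0 Va.
    by move=> /eqP; rewrite subr_eq => /eqP ->; rewrite addrC.
- move=> -> [[V dmu] [dxi dnu]] /=.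
  rewrite TRK !to_covecE // !to_vecE // TRVK.
  have -> : phi ((V, dmu), (dxi, dnu))
     = phi ((V, 0), (0, 0)) + phi ((0, dmu), (0, 0))
       + (phi ((0, 0), (dxi, 0)) + phi ((0, 0), (0, dnu))).
    rewrite -!phiD; congr phi.
    by congr ((_, _), (_, _)) => /=; rewrite !(addr0, add0r).
  rewrite !opprD.
  set x1 := phi _; set x2 := phi _; set x3 := pairing _ _; set x4 := phi _.
  set x5 := phi _.
  ring.
Qed.

End Tulczyjew.

(** * The reduction *)

Lemma dfun_linear (R : realType) (E : normedModType R) (M : topologicalType)
    (A : atlas E M) f p c u v :
  dfun A f p (c *: u + v) = c * dfun A f p u + dfun A f p v.
Proof. exact: linearP. Qed.

Lemma smooth_fun_differentiable (R : realType) (E : normedModType R)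
    (M : topologicalType) (A : atlas E M) f p :
  local_charts A -> smooth_fun A f ->
  differentiable (f \o unchart A p) (chart A p p).
Proof.
move=> hA fs.
exact: (smooth_map_mdifferentiable p hA (vec_local_charts _) fs).
Qed.

(** Chain rule for a map with an explicit local expression [L]. The comparison goes through
    [unchart] alone and holds everywhere, so no chart domain has to be controlled. *)
Lemma dfun_comp (R : realType) (E F : normedModType R) (M N : topologicalType)
    (A : atlas E M) (B : atlas F N) (f : N -> R) (g : M -> N) p (L dL : E -> F)
    v :
  is_diff (chart A p p) L dL ->
  (forall x, f (g (unchart A p x)) = f (unchart B (g p) (L x))) ->
  L (chart A p p) = chart B (g p) (g p) ->
  differentiable (f \o unchart B (g p)) (chart B (g p) (g p)) ->
  dfun A (f \o g) p v = dfun B f (g p) (dL v).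
Proof.
move=> [dL1 dL2] fgE Lp df; rewrite /dfun /tmap /=.
have -> : id \o (f \o g) \o unchart A p = (f \o unchart B (g p)) \o L.
  exact/funext.
have df' : differentiable (f \o unchart B (g p)) (L (chart A p p)) by rewrite Lp.
apply: etrans (congr1 (@^~ v) (diff_comp dL1 df')) _.
by rewrite /= dL2 Lp.
Qed.

Section Reduction.
Context {R : realType} {n : nat}.
Variable G : lieGroup R n.
Local Notation A := (lie_atlas G).
Local Notation TA := (TTstar_atlas G).
Local Notation RA := (reduced_atlas G).
Local Notation LA := (vec_atlas 'cV[R]_n).

Let hA : local_charts A.
Proof. exact: manifold_local_charts (lie_manifold G). Qed.

Let hT : local_charts TA.
Proof.
by do !apply: prod_local_charts => //; exact: vec_local_charts.
Qed.

Let hR : local_charts RA.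
Proof.
by do !apply: prod_local_charts => //; exact: vec_local_charts.
Qed.

Let chartK (g : G) : unchart A g (chart A g g) = g.
Proof. by rewrite lc_chartK //; exact: lc_dom_self. Qed.

(** Existence of a solution makes the [get] in [ham_vf] a solution; uniqueness identifies it with
    the explicit one. *)
Lemma ham_vfE f p :
  ham_vf TA (@tulczyjew R n G) f p = tulczyjew_sol p (dfun TA f p).
Proof.
apply/tulczyjew_solP; first by move=> c x y; exact: dfun_linear.
rewrite /ham_vf.
set S := [set u | _]; have [u Su] : exists u, S u.
  exists (tulczyjew_sol p (dfun TA f p)).
  by apply/tulczyjew_solP => // c x y; exact: dfun_linear.
exact: (@getPex _ S (ex_intro _ u Su)).
Qed.

(** In charts the action is a translation of the model space, whose differential is the identity. *)
Lemma dfun_psi f l p v : smooth_fun TA f ->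
  dfun TA (f \o psi l) p v = dfun TA f (psi l p) v.
Proof.
move=> fs; have df := smooth_fun_differentiable (psi l p) hT fs.
apply: (@dfun_comp _ _ _ _ _ TA TA f (psi l) p
  (fun x => x + ((0, l), (0, 0))) id) => //.
- exact: add_cst_is_diff.
- by case: p {df} => [[g mu] [xi nu]] [[x m] [y k]] /=; rewrite !addr0.
- by case: p {df} => [[g mu] [xi nu]] /=; congr ((_, _), (_, _)); rewrite addr0.
Qed.

Lemma dfun_reduced_proj e p v : smooth_fun RA e ->
  dfun TA (e \o @reduced_proj R n G) p v
  = dfun RA e (reduced_proj p) (v.1.1, v.2).
Proof.
move=> es; have de := smooth_fun_differentiable (reduced_proj p) hR es.
apply: (@dfun_comp _ _ _ _ _ TA RA e (@reduced_proj R n G) p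
  (fun x => (x.1.1, x.2)) (fun x => (x.1.1, x.2))) => //.
- exact: reduced_is_diff.
- by case: p {de} => [[g mu] [xi nu]] [[x m] [y k]].
- by case: p {de} => [[g mu] [xi nu]].
Qed.

(** A partial derivative is the total differential composed with that of a slice inclusion; likewise
    for nu below. *)
Lemma pairing_partial_g e (p : reduced G) V : smooth_fun RA e ->
  pairing (partial_g e p) V = dfun RA e p (V, (0, 0)).
Proof.
case: p => g [xi nu] es /=; rewrite to_covecE; last by move=> *; exact: dfun_linear.
have de := smooth_fun_differentiable (g, (xi, nu)) hR es.
apply: (@dfun_comp _ _ _ _ _ A RA e (fun h => (h, (xi, nu))) g
  (fun x => (x, (xi, nu))) (fun x => (x, (0, 0)))) => //.
Qed.

Lemma pairing_partial_nu e (p : reduced G) m : smooth_fun RA e ->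
  pairing m (partial_nu e p) = dfun RA e p (0, (0, m)).
Proof.
case: p => g [xi nu] es /=; rewrite to_vecE; last by move=> *; exact: dfun_linear.
have de := smooth_fun_differentiable (g, (xi, nu)) hR es.
apply: (@dfun_comp _ _ _ _ _ (vec_atlas _) RA e (fun k => (g, (xi, k))) nu
  (fun x => (chart A g g, (xi, x))) (fun x => (0, (0, x)))) => //.
  have H := cst_pair_is_diff nu xi.
  exact: (is_diff_pair (is_diff_cst (chart A g g) nu) H).
by move=> x /=; rewrite chartK.
Qed.

Lemma poisson_reduced e f p : smooth_fun RA e -> smooth_fun RA f ->
  poisson TA (@tulczyjew R n G) (e \o @reduced_proj R n G)
    (f \o @reduced_proj R n G) p
  = reduced_bracket e f (reduced_proj p).
Proof.
move=> es fs; rewrite /poisson dfun_reduced_proj // ham_vfE.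
case: p => [[g mu] [xi nu]] /=.
set p := (g, (xi, nu)) : reduced G.
set a := to_vec _; have -> : a = partial_nu e p.
  apply: eq_pairing_r => m; rewrite pairing_partial_nu // to_vecE.
    by rewrite dfun_reduced_proj.
  move=> c x y; rewrite !dfun_reduced_proj //= -dfun_linear.
  by congr dfun; congr (_, (_, _)) => /=; rewrite ?scaler0 ?addr0.
(* [b] is the delta-xi component, that is, the mu-derivative of the pulled-back [e], which vanishes
   by invariance. *)
set b := to_vec _; have -> : b = 0.
  apply: eq_pairing_r => m; rewrite pairing0r to_vecE.
    by rewrite dfun_reduced_proj //; exact: linear0.
  move=> c x y; rewrite !dfun_reduced_proj //= -dfun_linear.
  by congr dfun; congr (_, (_, _)) => /=; rewrite ?scaler0 ?addr0.
set d := to_covec _.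
have dfunD u v : dfun RA f p (u + v) = dfun RA f p u + dfun RA f p v.
  exact: linearD.
(* With no delta-xi component left, the differential of [f] splits into its g and nu partials. *)
have -> : (TR g 1%g (partial_nu e p), (0, d))
   = (TR g 1%g (partial_nu e p), (0, 0)) + (0, (0, d)) :> @reduced_model R n.
  by congr (_, (_, _)); rewrite ?addr0 ?add0r.
rewrite dfunD -pairing_partial_g // -pairing_partial_nu //.
(* The delta-nu component supplies the last two terms of the bracket. *)
have -> : pairing d (partial_nu f p)
    = pairing nu (lieb G (partial_nu e p) (partial_nu f p))
      - pairing (partial_g e p) (TR g 1%g (partial_nu f p)).
  rewrite /d to_covecE => [|c x y].
    by rewrite dfun_reduced_proj // -pairing_partial_g.
  rewrite !dfun_reduced_proj //= -!pairing_partial_g //.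
  rewrite lieb_linear TR_linear !pairing_linear mulrBr.
  by rewrite opprD addrACA.
rewrite !pairing_TstarR.
move: (pairing (partial_g f p) _) (pairing nu _) (pairing (partial_g e p) _).
by move=> x y z; rewrite addrA addrAC.
Qed.

(** * Smoothness of the action and of the projection *)

Lemma psi_continuous :
  continuous (fun lp : 'cV[R]_n * TTstar G => psi lp.1 lp.2).
Proof.
have -> : (fun lp : 'cV[R]_n * TTstar G => psi lp.1 lp.2)
    = (fun lp => ((lp.2.1.1, lp.2.1.2 + lp.1), lp.2.2)).
  by apply/funext => -[l [[g mu] [xi nu]]].
have c21 := continuousT_comp (@continuous_snd 'cV[R]_n (TTstar G))
  (@continuous_fst _ _).
have cD : continuous (fun lp : 'cV[R]_n * TTstar G => lp.2.1.2 + lp.1).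
  move=> x; apply: cvgD; last exact: continuous_fst.
  exact: (continuousT_comp c21 (@continuous_snd _ _)).
have cG := continuousT_comp c21 (@continuous_fst _ _).
have c22 := continuousT_comp (@continuous_snd 'cV[R]_n (TTstar G))
  (@continuous_snd _ _).
exact: (continuous_pair (continuous_pair cG cD) c22).
Qed.

(** In charts, the group slot is a transition map of [G] after a projection, and the remaining slots
    are linear in the pair (lambda, p). *)
Lemma psi_smooth :
  smooth_map (prod_atlas LA TA) TA (fun lp => psi lp.1 lp.2).
Proof.
split; first exact: psi_continuous.
move=> p q k; set O := (X in Ck k X).
have Oo : open O.
  apply: open_chart_image.
    by apply: prod_local_charts => //; exact: vec_local_charts.
  by apply: open_comp; [move=> x _; exact: psi_continuous|exact: lc_dom_open].
pose t := chart A q.1.1 \o unchart A p.2.1.1.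
have -> : chart TA q \o (fun lp => psi lp.1 lp.2) \o unchart (prod_atlas LA TA) p
    = (fun x => ((t x.2.1.1, x.2.1.2 + x.1), x.2.2)).
  by apply/funext => -[l [[x m] [y k']]].
apply: (Ck_pair Oo); first apply: (Ck_pair Oo).
- apply: (@Ck_comp_linear _ _ _ _ _ (chart A p.2.1.1 @`
     (dom A p.2.1.1 `&` dom A q.1.1)) O (fun x => x.2.1.1) t) => //.
  + exact: (continuousT_comp (continuousT_comp (@continuous_snd _ _)
      (@continuous_fst _ _)) (@continuous_fst _ _)).
  + move=> _ [[l [[g m] [y k']]] [/= [_ [[/= dg _] _]] [[/= dg' _] _]] <-].
    by exists g.
  + exact: (smfd_transition (lie_manifold G) p.2.1.1 q.1.1 k).
- apply: Ck_linear.
  + by move=> c x y /=; rewrite scalerDr addrACA.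
  + move=> x; apply: cvgD; last exact: continuous_fst.
    exact: (continuousT_comp (continuousT_comp (@continuous_snd _ _)
      (@continuous_fst _ _)) (@continuous_snd _ _)).
- apply: Ck_linear => // x.
  by apply: continuous_comp; exact: continuous_snd.
Qed.

Lemma reduced_proj_continuous : continuous (@reduced_proj R n G).
Proof.
have -> : @reduced_proj R n G = (fun p => (p.1.1, p.2)).
  by apply/funext => -[[g mu] [xi nu]].
exact: (continuous_pair (continuousT_comp (@continuous_fst _ _)
  (@continuous_fst _ _)) (@continuous_snd _ _)).
Qed.

Lemma reduced_proj_smooth : smooth_map TA RA (@reduced_proj R n G).
Proof.
split; first exact: reduced_proj_continuous.
move=> p q k; set O := (X in Ck k X).
have Oo : open O.
  apply: open_chart_image => //.
  apply: open_comp; last exact: lc_dom_open.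
  by move=> x _; exact: reduced_proj_continuous.
pose t := chart A q.1 \o unchart A p.1.1.
have -> : chart RA q \o @reduced_proj R n G \o unchart TA p
    = (fun x => (t x.1.1, x.2)).
  by apply/funext => -[[x m] [y k']].
apply: (Ck_pair Oo).
- apply: (@Ck_comp_linear _ _ _ _ _ (chart A p.1.1 @`
     (dom A p.1.1 `&` dom A q.1)) O (fun x => x.1.1) t) => //.
  + by move=> x; apply: continuous_comp; exact: continuous_fst.
  + by move=> _ [[[g m] [y k']] [/= [[/= dg _] _] [/= dg' _]] <-]; exists g.
  + exact: (smfd_transition (lie_manifold G) p.1.1 q.1 k).
- by apply: Ck_linear => // x; exact: continuous_snd.
Qed.

Lemma reduced_proj_tmap p v : tmap TA RA (@reduced_proj R n G) p v = (v.1.1, v.2).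
Proof.
suff H : is_diff (chart TA p p)
    (chart RA (reduced_proj p) \o @reduced_proj R n G \o unchart TA p)
    (fun y => (y.1.1, y.2)).
  by rewrite /tmap diff_val.
(* The local expression differs from the bare projection by chart-unchart composites, trivial near
   [p]. *)
apply: near_eq_is_diff (reduced_is_diff _).
apply: filterS (near_unchartK p hT) => x /(congr1 (fun y => (y.1.1, y.2))).
by case: p x => [[g mu] [xi nu]] [[x m] [y k]] /= ->.
Qed.

(** A global section of [reduced_proj] meeting each orbit once; restricting an invariant function to
    it gives the function induced on the quotient. *)
Definition zero_section (r : reduced G) : TTstar G := ((r.1, 0), r.2).

Lemma smooth_fun_zero_section f :
  smooth_fun TA f -> smooth_fun RA (f \o zero_section).
Proof.
move=> [fc fs]; split.
  by apply: continuousT_comp fc; exact: zero_section_continuous.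
move=> p q k.
apply: (@Ck_comp_linear _ _ _ _ _ _ _ (fun x => ((x.1, 0), x.2)) _ _ _ _
  (fs (zero_section p) q k)).
- by move=> c x y; congr ((_, _), _) => /=; rewrite ?scaler0 ?addr0.
- exact: zero_section_continuous.
- move=> _ [[g r] [/= [/= dg _] _] <-].
  by exists (zero_section (g, r)).
Qed.

End Reduction.

Theorem proposition6p11 (R : realType) (n : nat) (G : lieGroup R n) :
  (forall f : TTstar G -> R, smooth_fun (TTstar_atlas G) f ->
     exists! X, hamiltonian (TTstar_atlas G) (@tulczyjew R n G) f X)
  /\
  poisson_reduction (TTstar_atlas G) (reduced_atlas G)
    (poisson (TTstar_atlas G) (@tulczyjew R n G))
    (@psi R n G) (@reduced_proj R n G) (@reduced_bracket R n G).
Proof.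
split.
  move=> f _; exists (fun p => tulczyjew_sol p (dfun (TTstar_atlas G) f p)).
  split=> [p|X hX].
    by apply/tulczyjew_solP => // c x y; exact: dfun_linear.
  apply/funext => p; apply/esym/tulczyjew_solP; last exact: hX.
  by move=> c x y; exact: dfun_linear.
split.
- by move=> [[g mu] [xi nu]] /=; rewrite addr0.
- by move=> l l' [[g mu] [xi nu]] /=; rewrite -addrA (addrC l).
- exact: psi_smooth.
- move=> l f h fs hs; apply/funext => p.
  apply: etrans (dfun_psi l p _ hs) _.
  have fE : dfun (TTstar_atlas G) (f \o psi l) p
      = dfun (TTstar_atlas G) f (psi l p) by apply/funext => v; exact: dfun_psi.
  (* The explicit solution involves only g and nu of the base point, and [psi] moves only mu. *)
  have solE phi : tulczyjew_sol p phi = tulczyjew_sol (psi l p) phi.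
    by case: p {fE} => [[g mu] [xi nu]].
  by rewrite ham_vfE fE solE -ham_vfE.
- exact: reduced_proj_smooth.
- by move=> [g [xi nu]]; exists ((g, 0), (xi, nu)).
- by move=> p [V w]; exists ((V, 0), w); rewrite reduced_proj_tmap.
- move=> [[g mu] [xi nu]] [[g' mu'] [xi' nu']] /=; split=> [[-> -> ->]|[l]].
    (* Points of a fibre differ by a translation in mu. *)
    by exists (mu' - mu); rewrite addrC subrK.
  by move=> [-> _ -> ->].
- move=> f fs finv; exists (f \o zero_section (G := G)).
    exact: smooth_fun_zero_section.
  apply/funext => -[[g mu] [xi nu]] /=.
  (* Acting by [- mu] brings the point onto the zero section. *)
  by rewrite -[in LHS](finv (- mu)) /= subrr.
- by move=> e f es fs; apply/funext => p; exact: poisson_reduced.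
Qed.
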